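(* Let $M$ be a nilmanifold with underlying Lie algebra isomorphic to $\mathfrak h_3$. For any invariant balanced Hermitian structure $(J,F)$ on $M$ there is an invariant $\mathrm{SU}(3)$-instanton solving the Strominger system (with constant dilaton, and with the Bismut connection in the anomaly cancellation condition). Moreover, the Bismut connection associated to $(J,F)$ is of instanton type (i.e. its curvature $2$-forms lie in $\mathfrak{su}(3)$), and therefore such solutions also solve the heterotic equations of motion.
   Context: A nilmanifold is a compact quotient $M=\Gamma\backslash G$ of a simply-connected nilpotent Lie group by a lattice of maximal rank; its underlying Lie algebra is the Lie algebra $\mathfrak g$ of $G$. Invariant objects on $M$ are those induced by left-invariant objects on $G$; an invariant connection is one whose connection forms in a left-invariant coframe are left-invariant $1$-forms. $\mathfrak h_3$ is the Lie algebra whose dual has a basis with $de^1=\cdots=de^5=0$, $de^6=e^1\wedge e^2+e^3\wedge e^4$. A complex structure $J$ acts on $1$-forms by $(J\alpha)(X)=-\alpha(JX)$. A Hermitian structure $(J,F)$ with metric $g$ has $F(X,Y)=g(X,JY)$, and is balanced (in dimension 6) if $d(F\wedge F)=0$. The Bismut connection is $\nabla=\nabla^g+\frac12T$, with $\nabla^g$ the Levi-Civita connection and $T=JdF$, i.e. $T(X,Y,Z)=-dF(JX,JY,JZ)$. For an invariant balanced Hermitian structure, fix an invariant orthonormal coframe $\{e^1,\ldots,e^6\}$ with $Je^1=-e^2$, $Je^3=-e^4$, $Je^5=-e^6$, $F=e^{12}+e^{34}+e^{56}$ ($e^{ij}=e^i\wedge e^j$), with dual frame $\{e_1,\ldots,e_6\}$,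 and the $\mathrm{SU}(3)$-structure $(J,F,\Psi)$ with $\Psi=(e^1+ie^2)\wedge(e^3+ie^4)\wedge(e^5+ie^6)$. For a connection with connection forms $\sigma^i_j$, the curvature forms are $\Omega^i_j=d\sigma^i_j+\sum_k\sigma^i_k\wedge\sigma^k_j$. An $\mathrm{SU}(3)$-instanton is an $\mathrm{SU}(3)$-connection $A$ (preserving $F$ and $\Psi$) whose curvature $2$-forms lie in $\mathfrak{su}(3)$, i.e. for all $i,j,k,l$: $(\Omega^A)^i_j(e_1,e_2)+(\Omega^A)^i_j(e_3,e_4)+(\Omega^A)^i_j(e_5,e_6)=0$ and $(\Omega^A)^i_j(Je_k,Je_l)=(\Omega^A)^i_j(e_k,e_l)$. A solution of the Strominger system with constant dilaton is a compact $6$-manifold with a Hermitian $\mathrm{SU}(3)$-structure $(J,F,\Psi)$ such that: (a) the holonomy of the Bismut connection $\nabla$ is contained in $\mathrm{SU}(3)$; (b) $(J,F)$ is balanced; (c) there is an $\mathrm{SU}(3)$-instanton $A$, required to be non-flat; (d) $dT=2\pi^2\alpha'\big(p_1(\nabla)-p_1(A)\big)$ for some constant $\alpha'>0$, where $p_1=\frac{1}{8\pi^2}\sum_{1\le i<j\le 6}\Omega^i_j\wedge\Omega^i_j$. (An instanton $A$ ''solves the Strominger system'' if (a)-(d) hold with it.) A solution of the Strominger system is said to solve the heterotic equations of motion if and only if the connection $\nabla$ used in the anomaly cancellation condition (d) is an $\mathrm{SU}(3)$-instanton; this is Ivanov's characterization and is how the term is used here. *)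

(* Defs.v *)
From HB Require Import structures.
From mathcomp Require Import all_boot all_order all_algebra.
From mathcomp Require Import all_classical all_reals all_analysis.
From mathcomp Require Import complex ring lra.

Set Implicit Arguments.
Unset Strict Implicit.
Unset Printing Implicit Defensive.

Import Order.TTheory GRing.Theory Num.Theory.
Import numFieldNormedType.Exports.

Local Open Scope classical_set_scope.
Local Open Scope ring_scope.

(* A six-dimensional real Lie algebra is R^6 = 'rV[R]_6 with a bracket br,     *)
(* its elements being the left-invariant vector fields on the simply connected *)
(* Lie group G. A left-invariant k-form is a function of k such vectors; on    *)
(* these the exterior derivative is the Chevalley-Eilenberg differential       *)
(*   d a (X_0, ..., X_k)                                                       *)
(*     = \sum_(i < j) (-1)^(i + j) a ([X_i, X_j], X_0, .. omit i, j .., X_k),  *)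
(* and (a /\ b)(X, Y) = a(X) b(Y) - a(Y) b(X) for 1-forms.                     *)

Definition o1 : 'I_6 := @Ordinal 6 0 isT.
Definition o2 : 'I_6 := @Ordinal 6 1 isT.
Definition o3 : 'I_6 := @Ordinal 6 2 isT.
Definition o4 : 'I_6 := @Ordinal 6 3 isT.
Definition o5 : 'I_6 := @Ordinal 6 4 isT.
Definition o6 : 'I_6 := @Ordinal 6 5 isT.

Section Forms.
Variable R : realType.
Local Notation V := 'rV[R]_6.

Definition form1 := V -> R.
Definition form2 := V -> V -> R.
Definition form3 := V -> V -> V -> R.
Definition form4 := V -> V -> V -> V -> R.
Definition form5 := V -> V -> V -> V -> V -> R.

Definition wedge11 (a b : form1) : form2 := fun X Y => a X * b Y - a Y * b X.

Definition wedge22 (a b : form2) : form4 := fun X Y Z W =>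
  a X Y * b Z W - a X Z * b Y W + a X W * b Y Z
  + a Y Z * b X W - a Y W * b X Z + a Z W * b X Y.

Variable br : V -> V -> V.

Definition d1 (a : form1) : form2 := fun X Y => - a (br X Y).

Definition d2 (a : form2) : form3 := fun X Y Z =>
  - a (br X Y) Z + a (br X Z) Y - a (br Y Z) X.

Definition d3 (a : form3) : form4 := fun X Y Z W =>
  - a (br X Y) Z W + a (br X Z) Y W - a (br X W) Y Z
  - a (br Y Z) X W + a (br Y W) X Z - a (br Z W) X Y.

Definition d4 (a : form4) : form5 := fun X Y Z W U =>
  - a (br X Y) Z W U + a (br X Z) Y W U - a (br X W) Y Z U + a (br X U) Y Z W
  - a (br Y Z) X W U + a (br Y W) X Z U - a (br Y U) X Z W
  - a (br Z W) X Y U + a (br Z U) X Y W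
  - a (br W U) X Y Z.

End Forms.

Section LieAlgebra.
Variable R : realType.
Local Notation V := 'rV[R]_6.
Variable br : V -> V -> V.

Record lie_bracket : Prop := LieBracket {
  lie_linear_l : forall y, linear (fun x => br x y);
  lie_linear_r : forall x, linear (br x);
  lie_alt : forall x, br x x = 0;
  lie_jacobi : forall x y z,
    br x (br y z) + br y (br z x) + br z (br x y) = 0 }.

(* eps is a basis of the dual space: the columns of an invertible matrix B. *)
Definition dual_basis (eps : 'I_6 -> form1 R) : Prop :=
  exists2 B : 'M[R]_6, B \in unitmx & forall i x, eps i x = (x *m B) 0 i.

Definition isomorphic_to_h3 : Prop :=
  exists eps : 'I_6 -> form1 R,
    [/\ dual_basis eps,
        forall i X Y, i != o6 -> d1 br (eps i) X Y = 0
      & forall X Y, d1 br (eps o6) X Y =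
          wedge11 (eps o1) (eps o2) X Y + wedge11 (eps o3) (eps o4) X Y].

(* The simply connected group G of a two-step nilpotent Lie algebra (such as   *)
(* h3) in exponential coordinates: by the Baker-Campbell-Hausdorff formula it  *)
(* is R^6 with the product gmul, unit 0 and inverse x |-> - x.                 *)
Definition gmul (x y : V) : V := x + y + 2^-1 *: br x y.

(* Gam is a discrete subgroup of G with compact quotient M = Gam \ G. *)
Record lattice (Gam : set V) : Prop := Lattice {
  lattice_1 : Gam 0;
  lattice_mul : forall x y, Gam x -> Gam y -> Gam (gmul x y);
  lattice_inv : forall x, Gam x -> Gam (- x);
  lattice_discrete : exists2 eps : R,
    0 < eps & forall x, Gam x -> `|x| < eps -> x = 0;
  lattice_cocompact : exists2 K : set V,
    compact K & forall x, exists c k, [/\ Gam c, K k & x = gmul c k] }.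

(* The velocity v at the point x of G, translated back to the unit: this is    *)
(* the derivative at s = 0 of gmul (- x) (x + s v).                            *)
Definition maurer_cartan (x v : V) : V := v - 2^-1 *: br x v.

End LieAlgebra.

Section Hermitian.
Variable R : realType.
Local Notation V := 'rV[R]_6.
Variables (br : V -> V -> V) (J : V -> V) (g : V -> V -> R).

Definition Jform (a : form1 R) : form1 R := fun X => - a (J X).

Record complex_structure : Prop := ComplexStructure {
  cs_linear : linear J;
  cs_square : forall x, J (J x) = - x;
  cs_nijenhuis : forall x y,
    br (J x) (J y) - J (br (J x) y) - J (br x (J y)) - br x y = 0 }.

Record inner_product : Prop := InnerProduct {
  ip_linear : forall x, scalar (g x);
  ip_sym : forall x y, g x y = g y x;
  ip_pos : forall x, x != 0 -> 0 < g x x }.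

Record hermitian_structure : Prop := Hermitian {
  herm_complex : complex_structure;
  herm_metric : inner_product;
  herm_compat : forall x y, g (J x) (J y) = g x y }.

Definition fundamental_form : form2 R := fun X Y => g X (J Y).

Definition balanced : Prop := forall X Y Z W U,
  d4 br (wedge22 fundamental_form fundamental_form) X Y Z W U = 0.

Definition torsion : form3 R := fun X Y Z =>
  - d2 br fundamental_form (J X) (J Y) (J Z).

(* levi_civita X Y Z is g(nabla^g_X Y, Z); this is the Koszul formula for      *)
(* left-invariant vector fields.                                               *)
Definition levi_civita : form3 R := fun X Y Z =>
  2^-1 * (g (br X Y) Z - g (br Y Z) X + g (br Z X) Y).

Definition bismut_cov : form3 R := fun X Y Z =>
  levi_civita X Y Z + 2^-1 * torsion X Y Z.

(* The coframe dual to e when e is orthonormal. *)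
Definition coframe (e : 'I_6 -> V) (i : 'I_6) : form1 R := g (e i).

Record adapted_frame (e : 'I_6 -> V) : Prop := AdaptedFrame {
  af_orthonormal : forall i j, g (e i) (e j) = (i == j)%:R;
  af_J12 : forall X, Jform (coframe e o1) X = - coframe e o2 X;
  af_J34 : forall X, Jform (coframe e o3) X = - coframe e o4 X;
  af_J56 : forall X, Jform (coframe e o5) X = - coframe e o6 X;
  af_F : forall X Y, fundamental_form X Y =
    wedge11 (coframe e o1) (coframe e o2) X Y
    + wedge11 (coframe e o3) (coframe e o4) X Y
    + wedge11 (coframe e o5) (coframe e o6) X Y }.

End Hermitian.

Lemma levi_civita_metric (R : realType) (br : 'rV[R]_6 -> 'rV[R]_6 -> 'rV[R]_6)
    (g : 'rV[R]_6 -> 'rV[R]_6 -> R) X Y Z :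
  lie_bracket br -> inner_product g ->
  levi_civita br g X Y Z + levi_civita br g X Z Y = 0.
Proof.
move=> [brl brr br0 _] [gl gs _].
have gD x y z : g x (y + z) = g x y + g x z.
  by rewrite -[y in LHS]scale1r gl mul1r.
have g0 x : g x 0 = 0 by apply: (@addrI _ (g x 0)); rewrite -gD !addr0.
have brDl x y z : br (x + y) z = br x z + br y z.
  by rewrite -[x in LHS]scale1r brl scale1r.
have brDr x y z : br x (y + z) = br x y + br x z.
  by rewrite -[y in LHS]scale1r brr scale1r.
have brC x y : br x y + br y x = 0.
  by have := br0 (x + y); rewrite brDl !brDr !br0 add0r addr0.
have gbrC x y z : g (br x y) z + g (br y x) z = 0.
  by rewrite !(gs _ z) -gD brC g0.
rewrite /levi_civita.
have := gbrC X Y Z; have := gbrC X Z Y; have := gbrC Y Z X.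
by lra.
Qed.

Lemma levi_civita_torsion_free (R : realType)
    (br : 'rV[R]_6 -> 'rV[R]_6 -> 'rV[R]_6)
    (g : 'rV[R]_6 -> 'rV[R]_6 -> R) X Y Z :
  lie_bracket br -> inner_product g ->
  levi_civita br g X Y Z - levi_civita br g Y X Z = g (br X Y) Z.
Proof.
move=> [brl brr br0 _] [gl gs _].
have gD x y z : g x (y + z) = g x y + g x z.
  by rewrite -[y in LHS]scale1r gl mul1r.
have g0 x : g x 0 = 0 by apply: (@addrI _ (g x 0)); rewrite -gD !addr0.
have brDl x y z : br (x + y) z = br x z + br y z.
  by rewrite -[x in LHS]scale1r brl scale1r.
have brDr x y z : br x (y + z) = br x y + br x z.
  by rewrite -[y in LHS]scale1r brr scale1r.
have brC x y : br x y + br y x = 0.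
  by have := br0 (x + y); rewrite brDl !brDr !br0 add0r addr0.
have gbrC x y z : g (br x y) z + g (br y x) z = 0.
  by rewrite !(gs _ z) -gD brC g0.
rewrite /levi_civita.
have := gbrC X Y Z; have := gbrC X Z Y; have := gbrC Y Z X.
by lra.
Qed.

(* Invariant connections, through their forms s i j = sigma^i_j in the frame   *)
(* e: nabla_X e_j = \sum_i sigma^i_j(X) e_i.                                   *)
Section Connections.
Variable R : realType.
Local Notation V := 'rV[R]_6.
Variables (br : V -> V -> V) (J : V -> V) (g : V -> V -> R) (e : 'I_6 -> V).

Definition connection := 'I_6 -> 'I_6 -> form1 R.

Definition invariant_connection (s : connection) : Prop :=
  forall i j, scalar (s i j).

Definition bismut : connection := fun i j X => bismut_cov br J g X (e j) (e i).

Definition curvature (s : connection) (i j : 'I_6) : form2 R := fun X Y =>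
  d1 br (s i j) X Y + \sum_(k < 6) wedge11 (s i k) (s k j) X Y.

Definition p1 (s : connection) : form4 R := fun X Y Z W =>
  (8 * pi ^+ 2)^-1 *
  \sum_(i < 6) \sum_(j < 6 | (i < j)%N)
     wedge22 (curvature s i j) (curvature s i j) X Y Z W.

Definition zeta (a : 'I_3) (X : V) : R[i] :=
  let re := tnth [tuple o1; o3; o5] a in
  let im := tnth [tuple o2; o4; o6] a in
  (coframe g e re X +i* coframe g e im X)%C.

(* The wedge product of three 1-forms is a determinant. *)
Definition Psi (X Y Z : V) : R[i] :=
  \det (\matrix_(a < 3, b < 3) zeta a (tnth [tuple X; Y; Z] b)).

(* The endomorphism with matrix P in the frame e. *)
Definition act (P : 'M[R]_6) (X : V) : V :=
  \sum_(i < 6) \sum_(j < 6) (P i j * coframe g e j X) *: e i.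

Local Notation F := (fundamental_form J g).

Definition in_SU3 (P : 'M[R]_6) : Prop :=
  (forall X Y, F (act P X) (act P Y) = F X Y) /\
  (forall X Y Z, Psi (act P X) (act P Y) (act P Z) = Psi X Y Z).

Definition conn_mx (s : connection) (X : V) : 'M[R]_6 := \matrix_(i, j) s i j X.

Definition preserves_F (s : connection) : Prop := forall U X Y,
  F (act (conn_mx s U) X) Y + F X (act (conn_mx s U) Y) = 0.

Definition preserves_Psi (s : connection) : Prop := forall U X Y Z,
  Psi (act (conn_mx s U) X) Y Z + Psi X (act (conn_mx s U) Y) Z
  + Psi X Y (act (conn_mx s U) Z) = 0.

Definition curvature_in_su3 (s : connection) : Prop := forall i j,
  (curvature s i j (e o1) (e o2) + curvature s i j (e o3) (e o4)
   + curvature s i j (e o5) (e o6) = 0) /\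
  (forall k l, curvature s i j (J (e k)) (J (e l)) =
               curvature s i j (e k) (e l)).

Record su3_instanton (s : connection) : Prop := Su3Instanton {
  inst_invariant : invariant_connection s;
  inst_F : preserves_F s;
  inst_Psi : preserves_Psi s;
  inst_curvature : curvature_in_su3 s }.

Definition non_flat (s : connection) : Prop :=
  exists i j X Y, curvature s i j X Y != 0.

(* parallel_transport s x y P: P is the matrix, in the left-invariant frame e, *)
(* of the parallel transport along some piecewise C^1 path of G from x to y.   *)
(* Along a path c, with derivative dc, the matrix u of the transport solves    *)
(* u' = - sigma(c^-1 dc) u; each C^1 piece is the restriction to [0, 1] of a   *)
(* C^1 curve defined on the whole real line.                                   *)
Inductive parallel_transport (s : connection) (x : V) : V -> 'M[R]_6 -> Prop :=
| transport_refl : parallel_transport s x x 1%:M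
| transport_step (P : 'M[R]_6) (c dc : R -> V) (u : R -> 'M[R]_6) of
    parallel_transport s x (c 0) P &
    (forall t i, is_derive t (1 : R) (fun r => c r 0 i) (dc t 0 i)) &
    (forall i, continuous (fun t => dc t 0 i)) &
    u 0 = 1%:M &
    (forall t i j, is_derive t (1 : R) (fun r => u r i j)
       ((- (conn_mx s (maurer_cartan br (c t) (dc t)) *m u t)) i j)) :
    parallel_transport s x (c 1) (u 1 *m P).

(* The holonomy group of the connection induced on M = Gam \ G, based at the   *)
(* class of the unit: loops there lift to paths of G from 0 to a point of Gam. *)
Definition holonomy (Gam : set V) (s : connection) : set 'M[R]_6 :=
  [set P | exists2 c, Gam c & parallel_transport s 0 c P].

(* A solves the Strominger system with constant dilaton on M = Gam \ G with    *)
(* the SU(3)-structure (J, F, Psi), with the Bismut connection in the anomaly  *)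
(* cancellation condition.                                                     *)
Record solves_strominger (Gam : set V) (A : connection) : Prop :=
  SolvesStrominger {
    strom_hermitian : hermitian_structure br J g;
    strom_frame : adapted_frame J g e;
    strom_holonomy : forall P, holonomy Gam bismut P -> in_SU3 P;
    strom_balanced : balanced br J g;
    strom_instanton : su3_instanton A;
    strom_non_flat : non_flat A;
    strom_anomaly : exists2 alpha' : R, 0 < alpha' &
      forall X Y Z W, d3 br (torsion br J g) X Y Z W =
        2 * pi ^+ 2 * alpha' * (p1 bismut X Y Z W - p1 A X Y Z W) }.

Definition solves_heterotic (Gam : set V) (A : connection) : Prop :=
  solves_strominger Gam A /\ su3_instanton bismut.

End Connections.

(* Main.v *)
Require Import Defs.
From HB Require Import structures.
From mathcomp Require Import all_boot all_order all_algebra.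
From mathcomp Require Import all_classical all_reals all_analysis.
From mathcomp Require Import complex ring lra.

Set Implicit Arguments.
Unset Strict Implicit.
Unset Printing Implicit Defensive.

Import Order.TTheory GRing.Theory Num.Theory.
Import numFieldNormedType.Exports.

Local Open Scope classical_set_scope.
Local Open Scope ring_scope.

(** Write the bracket of h_3 as [X, Y] = w(X, Y) z, with z spanning the derived
algebra and w a 2-form vanishing on z. The two conditions on the Hermitian
structure are then conditions on w alone. The vanishing of the Nijenhuis tensor,
an identity between a multiple of z and a multiple of J z, makes w invariant
under J ([bracket_form_J]); balancedness makes w trace-free with respect to F
([balanced_bracket_form_trace]). Together they say that the skew matrix
W = (w(e_i, e_j)) lies in su(3), in every adapted frame e.

Let eta = g(z, .). The J-invariance of w gives T = - w /\ eta, and in the sum of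
the Koszul formula and T / 2 all terms but one cancel: the Bismut connection has
forms sigma^i_j = w(e_i, e_j) eta ([bismut_eq]). It takes values in the line
spanned by W, so sigma /\ sigma = 0, and d eta = - |z|^2 w leaves
Omega^i_j = - |z|^2 w(e_i, e_j) w. Since W is in su(3), this connection
preserves F and Psi; since the 2-form w is in su(3), it is an instanton.

The same argument applies to the multiples lambda sigma. With N the sum of the
w(e_i, e_j)^2 over i < j, which is positive because w <> 0,
  8 pi^2 p_1(lambda sigma) = lambda^2 |z|^4 N (w /\ w)   and
  dT = |z|^2 (w /\ w),
so each lambda with 0 < lambda < 1 solves the anomaly equation with a positive
alpha'. The proof takes lambda = 1/2.

The holonomy condition holds for every invariant connection that preserves F and
Psi: along a parallel transport the derivatives of F and of Psi vanish, hence
both are constant ([transport_preserves]). *)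

(** * Finite sums and linear forms *)

Lemma ord6_ind (P : 'I_6 -> Prop) :
  P o1 -> P o2 -> P o3 -> P o4 -> P o5 -> P o6 -> forall i, P i.
Proof.
move=> P1 P2 P3 P4 P5 P6 [[|[|[|[|[|[|//]]]]]] hi].
- by rewrite (_ : Ordinal hi = o1) //; apply: val_inj.
- by rewrite (_ : Ordinal hi = o2) //; apply: val_inj.
- by rewrite (_ : Ordinal hi = o3) //; apply: val_inj.
- by rewrite (_ : Ordinal hi = o4) //; apply: val_inj.
- by rewrite (_ : Ordinal hi = o5) //; apply: val_inj.
- by rewrite (_ : Ordinal hi = o6) //; apply: val_inj.
Qed.

Lemma sum_ord6 (M : nmodType) (f : 'I_6 -> M) :
  \sum_(i < 6) f i = f o1 + f o2 + f o3 + f o4 + f o5 + f o6.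
Proof.
rewrite !big_ord_recl big_ord0 addr0 !addrA.
by congr (_ + _ + _ + _ + _ + _); congr f; apply: val_inj.
Qed.

Local Notation c1 := (@Ordinal 3 0 isT).
Local Notation c2 := (@Ordinal 3 1 isT).
Local Notation c3 := (@Ordinal 3 2 isT).

Lemma sum_ord3 (M : nmodType) (f : 'I_3 -> M) :
  \sum_(a < 3) f a = f c1 + f c2 + f c3.
Proof.
rewrite !big_ord_recl big_ord0 addr0 !addrA.
by congr (_ + _ + _); congr f; apply: val_inj.
Qed.

(** The rules for linear forms whose linearity is a hypothesis, as it is for g
and w below. *)
Section ScalarForms.
Variables (R : realType) (f : 'rV[R]_6 -> R).
Hypothesis hf : scalar f.

Lemma scalar_formD x y : f (x + y) = f x + f y.
Proof. by rewrite -[x in LHS]scale1r hf mul1r. Qed.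

Lemma scalar_form0 : f 0 = 0.
Proof. by apply: (@addrI _ (f 0)); rewrite -scalar_formD !addr0. Qed.

Lemma scalar_formZ a x : f (a *: x) = a * f x.
Proof. by rewrite -[_ *: _]addr0 hf scalar_form0 addr0. Qed.

Lemma scalar_formN x : f (- x) = - f x.
Proof. by rewrite -scaleN1r scalar_formZ mulN1r. Qed.

Lemma scalar_form_sum (c : 'I_6 -> R) (v : 'I_6 -> 'rV[R]_6) :
  f (\sum_i c i *: v i) = \sum_i c i * f (v i).
Proof.
rewrite (big_morph f scalar_formD scalar_form0).
by apply: eq_bigr => i _; exact: scalar_formZ.
Qed.

End ScalarForms.

(** * Orthonormal and adapted frames *)

Section OrthonormalFrames.
Variables (R : realType) (g : 'rV[R]_6 -> 'rV[R]_6 -> R).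
Hypothesis hg : inner_product g.

Lemma metric_nondegenerate x : (forall y, g x y = 0) -> x = 0.
Proof.
move=> gx0; apply/eqP; apply: contraT => /(ip_pos hg).
by rewrite gx0 ltxx.
Qed.

Lemma orthonormal_coord (e : 'I_6 -> 'rV[R]_6) :
  (forall i j, g (e i) (e j) = (i == j)%:R) ->
  forall (c : 'I_6 -> R) i, g (e i) (\sum_j c j *: e j) = c i.
Proof.
move=> eo c i; rewrite (scalar_form_sum (ip_linear hg _)) (bigD1 i) //= big1.
  by rewrite eo eqxx mulr1 addr0.
by move=> j ji; rewrite eo eq_sym (negbTE ji) mulr0.
Qed.

Lemma orthonormal_expansion (e : 'I_6 -> 'rV[R]_6) :
  (forall i j, g (e i) (e j) = (i == j)%:R) ->
  forall X, X = \sum_i g (e i) X *: e i.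
Proof.
move=> eo; have coord := orthonormal_coord eo.
pose E := \matrix_i e i.
have mulE v : v *m E = \sum_i v 0 i *: e i.
  by rewrite mulmx_sum_row; apply: eq_bigr => i _; rewrite rowK.
have Eu : E \in unitmx.
  rewrite -row_free_unit; apply: inj_row_free => v vE0.
  apply/rowP => i; rewrite mxE -(coord (fun j => v 0 j) i) -mulE vE0.
  exact: (scalar_form0 (ip_linear hg _)).
move=> X; rewrite -{1}[X](mulmxKV Eu) mulE.
apply: eq_bigr => i _; congr (_ *: _).
by rewrite -[in RHS](mulmxKV Eu X) mulE coord.
Qed.

(** A dimension count: fewer than six linear equations on R^6 have a nonzero
solution. Iterated, it replaces the Gram-Schmidt process. *)
Lemma orthogonal_unit_vector (s : seq 'rV[R]_6) : (size s < 6)%N ->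
  exists2 v, g v v = 1 & {in s, forall x, g x v = 0}.
Proof.
move=> s6.
(* The columns of G are the linear equations g x v = 0 for x in s. *)
pose G : 'M[R]_(6, size s) := \matrix_(i, j) g s`_j (delta_mx 0 i).
have gG j (v : 'rV[R]_6) : (v *m G) 0 j = g s`_j v.
  rewrite mxE [in RHS](row_sum_delta v) (scalar_form_sum (ip_linear hg _)).
  by apply: eq_bigr => i _; rewrite mxE.
have kn0 : kermx G != 0.
  rewrite -mxrank_eq0 mxrank_ker subn_eq0 -ltnNge.
  exact: leq_ltn_trans (rank_leq_col G) s6.
pose u := nz_row (kermx G).
have u0 : u != 0 by rewrite nz_row_eq0.
have uG : u *m G = 0 by apply/sub_kermxP; exact: nz_row_sub.
have guu := ip_pos hg u0.
exists ((Num.sqrt (g u u))^-1 *: u).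
  rewrite (scalar_formZ (ip_linear hg _)) (ip_sym hg).
  rewrite (scalar_formZ (ip_linear hg _)) mulrA -invfM -expr2 sqr_sqrtr ?ltW //.
  by rewrite mulVf ?gt_eqF.
move=> x xs; rewrite (scalar_formZ (ip_linear hg _)).
have xi : (index x s < size s)%N by rewrite index_mem.
have := gG (Ordinal xi) u.
by rewrite uG mxE /= nth_index // => <-; rewrite mulr0.
Qed.

End OrthonormalFrames.

Section AdaptedFrames.
Variables (R : realType) (br : 'rV[R]_6 -> 'rV[R]_6 -> 'rV[R]_6).
Variables (J : 'rV[R]_6 -> 'rV[R]_6) (g : 'rV[R]_6 -> 'rV[R]_6 -> R).
Hypothesis hJ : hermitian_structure br J g.
Let hg := herm_metric hJ.

Lemma metricNl x y : g (- x) y = - g x y.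
Proof. by rewrite (ip_sym hg) (scalar_formN (ip_linear hg _)) (ip_sym hg). Qed.

Lemma metricNr x y : g x (- y) = - g x y.
Proof. exact: (scalar_formN (ip_linear hg _)). Qed.

Lemma J_skew x y : g (J x) y = - g x (J y).
Proof.
by rewrite -(herm_compat hJ x) (cs_square (herm_complex hJ)) metricNr opprK.
Qed.

Lemma J_orth x : g x (J x) = 0.
Proof. by have := J_skew x x; rewrite (ip_sym hg) => ?; lra. Qed.

(** Unit vectors a, b, c, each orthogonal to the J-invariant span of the
previous ones, give the frame a, - J a, b, - J b, c, - J c. *)
Lemma adapted_frame_exists : exists e, adapted_frame J g e.
Proof.
have [a aa _] := orthogonal_unit_vector hg (s := [::]) isT.
have [b bb bo] := orthogonal_unit_vector hg (s := [:: a; J a]) isT.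
have [c cc co] := orthogonal_unit_vector hg (s := [:: a; J a; b; J b]) isT.
pose e (i : 'I_6) := nth 0 [:: a; - J a; b; - J b; c; - J c] i.
have ab : g a b = 0 by apply: bo; rewrite !inE eqxx.
have Jab : g (J a) b = 0 by apply: bo; rewrite !inE eqxx !orbT.
have ac : g a c = 0 by apply: co; rewrite !inE eqxx.
have Jac : g (J a) c = 0 by apply: co; rewrite !inE eqxx !orbT.
have bc : g b c = 0 by apply: co; rewrite !inE eqxx !orbT.
have Jbc : g (J b) c = 0 by apply: co; rewrite !inE eqxx !orbT.
have swap x y : g (J x) y = 0 -> g x (J y) = 0.
  by rewrite J_skew => /eqP; rewrite oppr_eq0 => /eqP.
have aJb := swap _ _ Jab; have aJc := swap _ _ Jac; have bJc := swap _ _ Jbc.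
have eo i j : g (e i) (e j) = (i == j)%:R.
  move: i j; apply: ord6_ind; apply: ord6_ind; rewrite /e /=;
  rewrite ?(metricNl, metricNr) ?(herm_compat hJ) ?opprK //;
  rewrite ?(J_orth, ab, Jab, aJb, ac, Jac, aJc, bc, Jbc, bJc) ?oppr0 //;
  rewrite (ip_sym hg);
  by rewrite ?(J_orth, ab, Jab, aJb, ac, Jac, aJc, bc, Jbc, bJc) ?oppr0.
exists e.
have JJ x y : g (- J x) (J y) = - g x y.
  by rewrite metricNl (herm_compat hJ).
have skew x Y : g x (J Y) = g (- J x) Y by rewrite metricNl J_skew opprK.
split=> // [X|X|X|X Y]; try by rewrite /Jform /coframe skew.
rewrite /fundamental_form (ip_sym hg) {1}(orthonormal_expansion hg eo X).
rewrite (scalar_form_sum (ip_linear hg _)) sum_ord6 /wedge11 /coframe.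
rewrite !(ip_sym hg (J Y)) /e /= !JJ !skew.
ring.
Qed.

End AdaptedFrames.

(** * Parallel transport preserves F and Psi *)

Section ComplexDerivative.
Variable R : realType.

(** The derivative of a complex-valued function of a real variable: it lets the
product rule be applied to Psi without splitting Psi into two real
polynomials. *)
Definition is_cderive (f : R -> R[i]) (t : R) (df : R[i]) : Prop :=
  is_derive t (1 : R) (fun r => complex.Re (f r)) (complex.Re df) /\
  is_derive t (1 : R) (fun r => complex.Im (f r)) (complex.Im df).

Let ReD (x y : R[i]) : complex.Re (x + y) = complex.Re x + complex.Re y.
Proof. by case: x y => [a b] [c d]. Qed.

Let ImD (x y : R[i]) : complex.Im (x + y) = complex.Im x + complex.Im y.
Proof. by case: x y => [a b] [c d]. Qed.

Let ReM (x y : R[i]) : complex.Re (x * y) =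
  complex.Re x * complex.Re y - complex.Im x * complex.Im y.
Proof. by case: x y => [a b] [c d]. Qed.

Let ImM (x y : R[i]) : complex.Im (x * y) =
  complex.Re x * complex.Im y + complex.Im x * complex.Re y.
Proof. by case: x y => [a b] [c d]. Qed.

Lemma is_cderiveD f h t df dh : is_cderive f t df -> is_cderive h t dh ->
  is_cderive (fun r => f r + h r) t (df + dh).
Proof.
move=> [f1 f2] [h1 h2]; rewrite /is_cderive ReD ImD.
under [fun r => complex.Re _]funext do rewrite ReD.
under [fun r => complex.Im _]funext do rewrite ImD.
by split; exact: is_deriveD.
Qed.

Lemma is_cderiveM f h t df dh : is_cderive f t df -> is_cderive h t dh ->
  is_cderive (fun r => f r * h r) t (df * h t + f t * dh).
Proof.
move=> [f1 f2] [h1 h2]; rewrite /is_cderive ReD ImD !ReM !ImM.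
under [fun r => complex.Re _]funext do rewrite ReM.
under [fun r => complex.Im _]funext do rewrite ImM.
split.
  apply: (is_derive_eq (is_deriveB (is_deriveM f1 h1) (is_deriveM f2 h2))).
  by rewrite /GRing.scale /=; ring.
apply: (is_derive_eq (is_deriveD (is_deriveM f1 h2) (is_deriveM f2 h1))).
by rewrite /GRing.scale /=; ring.
Qed.

Lemma is_cderiveN f t df : is_cderive f t df ->
  is_cderive (fun r => - f r) t (- df).
Proof.
case=> [f1 f2]; rewrite /is_cderive.
have ReN (x : R[i]) : complex.Re (- x) = - complex.Re x by case: x.
have ImN (x : R[i]) : complex.Im (- x) = - complex.Im x by case: x.
rewrite ReN ImN.
under [fun r => complex.Re _]funext do rewrite ReN.
under [fun r => complex.Im _]funext do rewrite ImN.
by split; exact: is_deriveN.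
Qed.

Lemma is_cderive_eq f t df df' : is_cderive f t df -> df = df' ->
  is_cderive f t df'.
Proof. by move=> ? <-. Qed.

Lemma is_cderive0_cst f x y : (forall t, is_cderive f t 0) -> f x = f y.
Proof.
move=> f0.
have hR : complex.Re (f x) = complex.Re (f y).
  apply: (is_derive_0_is_cst (f := fun r => complex.Re (f r))) => t.
  by case: (f0 t).
have hI : complex.Im (f x) = complex.Im (f y).
  apply: (is_derive_0_is_cst (f := fun r => complex.Im (f r))) => t.
  by case: (f0 t).
by case: (f x) (f y) hR hI => [a b] [c d] /= -> ->.
Qed.

End ComplexDerivative.

Lemma det3 (K : comNzRingType) (m : 'I_3 -> 'I_3 -> K) :
  \det (\matrix_(i, j) m i j) =
    m c1 c1 * (m c2 c2 * m c3 c3 - m c2 c3 * m c3 c2)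
    - m c1 c2 * (m c2 c1 * m c3 c3 - m c2 c3 * m c3 c1)
    + m c1 c3 * (m c2 c1 * m c3 c2 - m c2 c2 * m c3 c1).
Proof.
(* With entries indexed by nat, the indices in the expansions compute. *)
have [n mE] : exists n : nat -> nat -> K, forall i j : 'I_3, m i j = n i j.
  by exists (fun a b => m (inord a) (inord b)) => i j; rewrite !inord_val.
rewrite (expand_det_row _ c1) !big_ord_recl big_ord0 addr0 /cofactor.
rewrite !(expand_det_row _ ord0) !big_ord_recl !big_ord0 /cofactor.
rewrite !det_mx11 !mxE !mE /= /bump /=.
ring.
Qed.

Section Transport.
Variables (R : realType) (br : 'rV[R]_6 -> 'rV[R]_6 -> 'rV[R]_6).
Variables (J : 'rV[R]_6 -> 'rV[R]_6) (g : 'rV[R]_6 -> 'rV[R]_6 -> R).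
Variable e : 'I_6 -> 'rV[R]_6.
Hypotheses (hg : inner_product g) (he : adapted_frame J g e).

Lemma coframe_act P X i : coframe g e i (act g e P X) =
  \sum_j P i j * coframe g e j X.
Proof.
rewrite /coframe /act.
under eq_bigr do rewrite -scaler_suml.
exact: (orthonormal_coord hg (af_orthonormal he)).
Qed.

Lemma coframe_inj X Y : (forall i, coframe g e i X = coframe g e i Y) -> X = Y.
Proof.
move=> XY; rewrite (orthonormal_expansion hg (af_orthonormal he) X).
rewrite (orthonormal_expansion hg (af_orthonormal he) Y).
by apply: eq_bigr => i _; congr (_ *: _); exact: XY.
Qed.

Lemma act1 X : act g e 1%:M X = X.
Proof.
apply: coframe_inj => i; rewrite coframe_act (bigD1 i) //= big1 => [|j ji].
  by rewrite mxE eqxx mul1r addr0.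
by rewrite mxE eq_sym (negbTE ji) mul0r.
Qed.

Lemma actM P Q X : act g e (P *m Q) X = act g e P (act g e Q X).
Proof.
apply: coframe_inj => i; rewrite !coframe_act.
under eq_bigr do rewrite mxE mulr_suml.
rewrite exchange_big /=; apply: eq_bigr => j _.
by rewrite coframe_act mulr_sumr; apply: eq_bigr => k _; rewrite mulrA.
Qed.

Lemma actN P X : act g e (- P) X = - act g e P X.
Proof.
apply: coframe_inj => i; rewrite /coframe (scalar_formN (ip_linear hg _)).
rewrite -!/(coframe g e _ _) !coframe_act -sumrN.
by apply: eq_bigr => j _; rewrite mxE mulNr.
Qed.

Lemma Psi_expansion X Y Z : let ze := zeta g e in
  Psi g e X Y Z =
    ze c1 X * (ze c2 Y * ze c3 Z - ze c2 Z * ze c3 Y)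
    - ze c1 Y * (ze c2 X * ze c3 Z - ze c2 Z * ze c3 X)
    + ze c1 Z * (ze c2 X * ze c3 Y - ze c2 Y * ze c3 X).
Proof. exact: det3. Qed.

(** The derivative of a curve of tangent vectors, taken in frame coordinates:
these are the variables in which F and Psi are polynomials. *)
Definition coframe_derive (x : R -> 'rV[R]_6) t dx := forall i,
  is_derive t (1 : R) (fun r => coframe g e i (x r)) (coframe g e i dx).

Lemma is_derive_F x y t dx dy :
  coframe_derive x t dx -> coframe_derive y t dy ->
  is_derive t (1 : R) (fun r => fundamental_form J g (x r) (y r))
    (fundamental_form J g dx (y t) + fundamental_form J g (x t) dy).
Proof.
move=> hx hy; under [fun r => _]funext do rewrite (af_F he).
rewrite !(af_F he) /wedge11.
have hxy i j :=
  is_deriveB (is_deriveM (hx i) (hy j)) (is_deriveM (hy i) (hx j)).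
apply: (is_derive_eq
  (is_deriveD (is_deriveD (hxy o1 o2) (hxy o3 o4)) (hxy o5 o6))).
by rewrite /GRing.scale /=; ring.
Qed.

Lemma is_cderive_zeta a x t dx : coframe_derive x t dx ->
  is_cderive (fun r => zeta g e a (x r)) t (zeta g e a dx).
Proof. by move=> hx; split; exact: hx. Qed.

Lemma is_cderive_Psi x y z t dx dy dz :
  coframe_derive x t dx -> coframe_derive y t dy -> coframe_derive z t dz ->
  is_cderive (fun r => Psi g e (x r) (y r) (z r)) t
    (Psi g e dx (y t) (z t) + Psi g e (x t) dy (z t) + Psi g e (x t) (y t) dz).
Proof.
move=> hx hy hz; under [fun r => _]funext do rewrite Psi_expansion.
rewrite !Psi_expansion /=.
have minor a b u v (du dv : 'rV[R]_6) :
    coframe_derive u t du -> coframe_derive v t dv ->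
    is_cderive (fun r => zeta g e a (u r) * zeta g e b (v r)
                         - zeta g e a (v r) * zeta g e b (u r)) t _ :=
  fun hu hv => is_cderiveD
    (is_cderiveM (is_cderive_zeta a hu) (is_cderive_zeta b hv))
    (is_cderiveN (is_cderiveM (is_cderive_zeta a hv) (is_cderive_zeta b hu))).
apply: (is_cderive_eq (is_cderiveD (is_cderiveD
  (is_cderiveM (is_cderive_zeta _ hx) (minor _ _ _ _ _ _ hy hz))
  (is_cderiveN (is_cderiveM (is_cderive_zeta _ hy) (minor _ _ _ _ _ _ hx hz))))
  (is_cderiveM (is_cderive_zeta _ hz) (minor _ _ _ _ _ _ hx hy)))).
ring.
Qed.

(** On each C^1 piece the transport u solves u' = - A u, where A is a value of
the connection. The derivative of F(u X, u Y) is then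
- (F(A u X, u Y) + F(u X, A u Y)) = 0, and likewise for Psi, so that u preserves
both forms because u(0) = 1 does. *)
Lemma transport_preserves (s : connection R) x y P :
  preserves_F J g e s -> preserves_Psi g e s ->
  parallel_transport br s x y P -> in_SU3 J g e P.
Proof.
move=> sF sPsi; elim=> {y P} [|P c dc u _ [PF PPsi] _ _ u0 du].
  by split=> *; rewrite !act1.
have hu X t : coframe_derive (fun r => act g e (u r) X) t
    (- act g e (conn_mx s (maurer_cartan br (c t) (dc t))) (act g e (u t) X)).
  rewrite -actM -actN => i.
  under [fun r => _]funext do rewrite coframe_act.
  rewrite coframe_act.
  rewrite [X in is_derive _ _ X _](_ : _ =
     \sum_j (coframe g e j X \*: (fun r => u r i j))); last first.
    apply/funext => r; rewrite fct_sumE; apply: eq_bigr => j _.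
    by rewrite mulrC.
  apply: (is_derive_eq (is_derive_sum (fun j =>
    is_deriveZ (coframe g e j X) (du t i j)))).
  by apply: eq_bigr => j _; exact: mulrC.
have FN1 X Y : fundamental_form J g (- X) Y = - fundamental_form J g X Y.
  rewrite !(af_F he) /wedge11 /coframe.
  by rewrite !(scalar_formN (ip_linear hg _)); ring.
have FN2 X Y : fundamental_form J g X (- Y) = - fundamental_form J g X Y.
  rewrite !(af_F he) /wedge11 /coframe.
  by rewrite !(scalar_formN (ip_linear hg _)); ring.
have zN a X : zeta g e a (- X) = - zeta g e a X.
  by rewrite /zeta /coframe !(scalar_formN (ip_linear hg _)).
split=> [X Y|X Y Z]; rewrite !actM.
  rewrite -(PF X Y); set X' := act g e P X; set Y' := act g e P Y.
  rewrite -[in RHS](act1 X') -[in RHS](act1 Y') -u0.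
  apply: (is_derive_0_is_cst (f := fun r =>
    fundamental_form J g (act g e (u r) X') (act g e (u r) Y'))) => t.
  apply: (is_derive_eq (is_derive_F (hu X' t) (hu Y' t))).
  by rewrite FN1 FN2 -opprD sF oppr0.
rewrite -(PPsi X Y Z); set X' := act g e P X; set Y' := act g e P Y.
set Z' := act g e P Z.
rewrite -[in RHS](act1 X') -[in RHS](act1 Y') -[in RHS](act1 Z') -u0.
apply: (is_cderive0_cst (f := fun r =>
  Psi g e (act g e (u r) X') (act g e (u r) Y') (act g e (u r) Z'))) => t.
apply: (is_cderive_eq (is_cderive_Psi (hu X' t) (hu Y' t) (hu Z' t))).
have := sPsi (maurer_cartan br (c t) (dc t))
  (act g e (u t) X') (act g e (u t) Y') (act g e (u t) Z').
rewrite !Psi_expansion /= !zN => /(congr1 (fun x => - x)); rewrite oppr0 => <-.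
ring.
Qed.

End Transport.

(** * Brackets of rank one *)

(** All brackets lie on the central line through z: a form of the hypothesis on
the Lie algebra that does not refer to a basis, so that it can be combined with
any adapted frame. *)
Record rank_one_bracket (R : realType) (br : 'rV[R]_6 -> 'rV[R]_6 -> 'rV[R]_6)
    (w : 'rV[R]_6 -> 'rV[R]_6 -> R) (z : 'rV[R]_6) : Prop := RankOneBracket {
  rob_linear : forall x, scalar (w x);
  rob_alt : forall x y, w x y = - w y x;
  rob_central : forall y, w z y = 0;
  rob_eq : forall x y, br x y = w x y *: z }.

(** Here z is the last vector of the basis dual to eps, and w = - d eps_6. *)
Lemma h3_rank_one (R : realType) (br : 'rV[R]_6 -> 'rV[R]_6 -> 'rV[R]_6) :
  isomorphic_to_h3 br ->
  exists w z, [/\ rank_one_bracket br w z, z != 0 & exists x y, w x y != 0].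
Proof.
move=> [eps [[B Bu epsE] deps0 deps6]].
pose w x y := - (wedge11 (eps o1) (eps o2) x y + wedge11 (eps o3) (eps o4) x y).
pose v i : 'rV[R]_6 := delta_mx 0 i *m invmx B.
have eps_v i j : eps i (v j) = (i == j)%:R.
  by rewrite epsE mulmxKV // mxE eqxx.
have eps_lin i a x y : eps i (a *: x + y) = a * eps i x + eps i y.
  by rewrite !epsE mulmxDl -scalemxAl mxE [X in X + _ = _]mxE.
exists w, (v o6); split.
- split=> [x a y y'|x y|y|x y].
  + by rewrite /w /wedge11 !eps_lin; ring.
  + by rewrite /w /wedge11; ring.
  + by rewrite /w /wedge11 !eps_v /= !mul0r; ring.
  apply: (can_inj (mulmxK Bu)); apply/rowP => i.
  rewrite -epsE -scalemxAl mulmxKV // !mxE eqxx /=.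
  have := deps6 x y; have := deps0 i x y; rewrite /d1.
  case: (eqVneq i o6) => [-> _ /(congr1 -%R)|_ /(_ isT) /eqP].
    by rewrite opprK mulr1.
  by rewrite oppr_eq0 mulr0 => /eqP.
- apply/eqP => v60; have := eps_v o6 o6.
  by rewrite v60 epsE mul0mx mxE => /esym /eqP; rewrite oner_eq0.
exists (v o1), (v o2); rewrite /w /wedge11 !eps_v /=.
by rewrite !(mul0r, mulr0) mulr1 !subr0 addr0 oppr_eq0 oner_eq0.
Qed.

Section RankOneGeometry.
Variables (R : realType) (br : 'rV[R]_6 -> 'rV[R]_6 -> 'rV[R]_6).
Variables (J : 'rV[R]_6 -> 'rV[R]_6) (g : 'rV[R]_6 -> 'rV[R]_6 -> R).
Variables (w : 'rV[R]_6 -> 'rV[R]_6 -> R) (z : 'rV[R]_6).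
Hypotheses (hJ : hermitian_structure br J g) (hw : rank_one_bracket br w z).
Hypothesis z0 : z != 0.

Let hg := herm_metric hJ.
Let gr := ip_linear hg.
Let wr := rob_linear hw.

Lemma bracket_form_scalar_l y : scalar (w^~ y).
Proof. by move=> a x x'; rewrite !(rob_alt hw _ y) wr; ring. Qed.
Let wl := bracket_form_scalar_l.

(** The Nijenhuis tensor of (x, y) is
(w(J x, J y) - w(x, y)) z - (w(J x, y) + w(x, J y)) J z, and z is orthogonal to
J z. *)
Lemma bracket_form_J x y : w (J x) (J y) = w x y.
Proof.
have [Jlin JJ nij] := herm_complex hJ.
have JZ a v : J (a *: v) = a *: J v.
  have J0 : J 0 = 0.
    apply: (@addrI _ (J 0)).
    by rewrite -[X in X + _]scale1r -Jlin scale1r !addr0.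
  by rewrite -[_ *: v]addr0 Jlin J0 addr0.
set a := w (J x) (J y) - w x y; set b := w (J x) y + w x (J y).
have ab : a *: z = b *: J z.
  apply/eqP; rewrite -subr_eq0; apply/eqP; rewrite -[RHS](nij x y).
  rewrite !(rob_eq hw) !JZ /a /b scalerBl scalerDl opprD.
  by rewrite -!addrA; congr (_ + _); rewrite addrC -addrA.
have : g z (a *: z) = 0 by rewrite ab (scalar_formZ (gr _)) (J_orth hJ) mulr0.
rewrite (scalar_formZ (gr _)) => /eqP.
by rewrite mulf_eq0 (gt_eqF (ip_pos hg z0)) orbF subr_eq0 => /eqP.
Qed.

Lemma bracket_form_J_skew x y : w (J x) y = - w x (J y).
Proof.
rewrite -(bracket_form_J x (J y)) (cs_square (herm_complex hJ)).
by rewrite (scalar_formN (wr _)) opprK.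
Qed.

Lemma F_bracket_l a X : fundamental_form J g (a *: z) X =
  a * fundamental_form J g z X.
Proof.
by rewrite /fundamental_form (ip_sym hg) (scalar_formZ (gr _)) (ip_sym hg).
Qed.

(** Here dF = - w /\ F(z, .), and J maps F(z, .) to eta up to sign while fixing
w. *)
Lemma torsion_rank_one X Y Z : torsion br J g X Y Z =
  - (w X Y * g z Z - w X Z * g z Y + w Y Z * g z X).
Proof.
rewrite /torsion /d2 !(rob_eq hw) !F_bracket_l !bracket_form_J.
rewrite /fundamental_form !(cs_square (herm_complex hJ)) !(metricNr hJ).
ring.
Qed.

(** Half the torsion cancels the terms of the Koszul formula in eta(Y) and eta(Z)
and doubles the one in eta(X). *)
Lemma bismut_rank_one X Y Z : bismut_cov br J g X Y Z = - g z X * w Y Z.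
Proof.
rewrite /bismut_cov /levi_civita torsion_rank_one !(rob_eq hw).
rewrite !(ip_sym hg (_ *: z)) !(scalar_formZ (gr _)) !(ip_sym hg _ z).
by rewrite (rob_alt hw Z X); field.
Qed.

(** As w is closed, d(w /\ eta) = w /\ d eta with d eta = - |z|^2 w. *)
Lemma d_torsion_rank_one X Y Z W : d3 br (torsion br J g) X Y Z W =
  g z z * wedge22 w w X Y Z W.
Proof.
have wZ a x y : w (a *: x) y = a * w x y by rewrite (scalar_formZ (wl y)).
rewrite /d3 !torsion_rank_one !(rob_eq hw) !wZ !(rob_central hw).
rewrite !(scalar_formZ (gr _)) /wedge22; ring.
Qed.

(** * The bracket form lies in su(3) *)

Section Frame.
Variable e : 'I_6 -> 'rV[R]_6.
Hypothesis he : adapted_frame J g e.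
Let eo := af_orthonormal he.

(** Up to a constant d(F /\ F) is w /\ i_z(F /\ F). As i_z w = 0, this 5-form is
the contraction with z of w /\ F /\ F, hence a multiple of t i_z vol, where t is
the trace of w. It vanishes, and i_z vol does not. *)
Lemma balanced_bracket_form_trace : balanced br J g ->
  w (e o1) (e o2) + w (e o3) (e o4) + w (e o5) (e o6) = 0.
Proof.
move=> hbal; set t := _ + _.
have wC i j := rob_alt hw (e i) (e j).
have wz j : \sum_k g (e k) z * w (e k) (e j) = 0.
  rewrite -[RHS](rob_central hw (e j)) {2}(orthonormal_expansion hg eo z).
  by rewrite (scalar_form_sum (wl _)).
pose Fee (i j : nat) : R := match i, j with
  | 0, 1 | 2, 3 | 4, 5 => 1%R | 1, 0 | 3, 2 | 5, 4 => (-1)%R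
  | _, _ => 0%R end%N.
have FeeE i j : fundamental_form J g (e i) (e j) = Fee i j.
  rewrite (af_F he) /wedge11 /coframe !eo.
  by move: i j; apply: ord6_ind; apply: ord6_ind => /=; ring.
pose Fze (j : nat) : R := match j with
  | 0 => - g (e o2) z | 1 => g (e o1) z | 2 => - g (e o4) z
  | 3 => g (e o3) z | 4 => - g (e o6) z | _ => g (e o5) z end.
have FzeE j : fundamental_form J g z (e j) = Fze j.
  rewrite (af_F he) /wedge11 /coframe !eo.
  by move: j; apply: ord6_ind => /=; ring.
(* The value of the 5-form on the frame vectors other than e_i is g (e i) z * t,
   up to a constant and the relations wz. *)
have tz i : g (e i) z * t = 0.
  have w0 k : w (e k) (e k) = 0 by have := wC k k; lra.
  have := wz o1; have := wz o2; have := wz o3.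
  have := wz o4; have := wz o5; have := wz o6; rewrite !sum_ord6 !w0.
  rewrite (wC o2 o1) (wC o3 o1) (wC o4 o1) (wC o5 o1) (wC o6 o1).
  rewrite (wC o3 o2) (wC o4 o2) (wC o5 o2) (wC o6 o2).
  rewrite (wC o4 o3) (wC o5 o3) (wC o6 o3) (wC o5 o4) (wC o6 o4) (wC o6 o5).
  have B j k l m n := hbal (e j) (e k) (e l) (e m) (e n).
  move: i; apply: ord6_ind;
    [have := B o2 o3 o4 o5 o6 | have := B o1 o3 o4 o5 o6
    |have := B o1 o2 o4 o5 o6 | have := B o1 o2 o3 o5 o6
    |have := B o1 o2 o3 o4 o6 | have := B o1 o2 o3 o4 o5];
    rewrite /d4 /wedge22 !(rob_eq hw) !F_bracket_l !FeeE !FzeE /= /t; lra.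
have [i zi] : exists i, g (e i) z != 0.
  apply: contrapT => h; case/eqP: z0; rewrite (orthonormal_expansion hg eo z).
  apply: big1 => i _.
  have [->|zi] := eqVneq (g (e i) z) 0; first exact: scale0r.
  by case: h; exists i.
by have /eqP := tz i; rewrite mulf_eq0 (negbTE zi) => /eqP.
Qed.

Definition re_index (a : 'I_3) : 'I_6 := tnth [tuple o1; o3; o5] a.
Definition im_index (a : 'I_3) : 'I_6 := tnth [tuple o2; o4; o6] a.

Lemma sum_re_im (M : nmodType) (f : 'I_6 -> M) :
  \sum_(i < 6) f i = \sum_(a < 3) (f (re_index a) + f (im_index a)).
Proof. by rewrite sum_ord6 sum_ord3 !addrA. Qed.

Lemma frame_J a : J (e (re_index a)) = - e (im_index a).
Proof.
have aux i j : (forall X, Jform J (coframe g e i) X = - coframe g e j X) ->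
    J (e i) = - e j.
  move=> h; apply/eqP; rewrite -subr_eq0 opprK; apply/eqP.
  apply: (metric_nondegenerate hg) => X.
  rewrite (ip_sym hg) (scalar_formD (gr _)) !(ip_sym hg X) (J_skew hJ).
  by have := h X; rewrite /Jform /coframe => ->; exact: addNr.
case: a => [[|[|[|//]]]] ha; apply: aux.
- exact: (af_J12 he).
- exact: (af_J34 he).
- exact: (af_J56 he).
Qed.

Definition bracket_mx : 'M[R]_6 := \matrix_(i, j) w (e i) (e j).

Lemma coframe_bracket_mx i X : coframe g e i (act g e bracket_mx X) = w (e i) X.
Proof.
rewrite (coframe_act hg he) {2}(orthonormal_expansion hg eo X).
rewrite (scalar_form_sum (wr _)); apply: eq_bigr => j _.
by rewrite mxE mulrC.
Qed.

Lemma metric_bracket_mx X Y : g (act g e bracket_mx X) Y = w Y X.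
Proof.
rewrite (orthonormal_expansion hg eo (act g e bracket_mx X)) (ip_sym hg).
rewrite (scalar_form_sum (gr _)) {2}(orthonormal_expansion hg eo Y).
rewrite (scalar_form_sum (wl _)); apply: eq_bigr => i _.
by rewrite -/(coframe g e i _) coframe_bracket_mx (ip_sym hg) mulrC.
Qed.

(** In terms of w the sum is w(J Y, X) + w(Y, J X), which vanishes because w is
skew and J-invariant. *)
Lemma bracket_mx_F X Y : fundamental_form J g (act g e bracket_mx X) Y
  + fundamental_form J g X (act g e bracket_mx Y) = 0.
Proof.
rewrite /fundamental_form metric_bracket_mx -[g X _]opprK -(J_skew hJ).
rewrite (ip_sym hg) metric_bracket_mx bracket_form_J_skew (rob_alt hw Y).
by rewrite opprK subrr.
Qed.

(** The matrix of [bracket_mx] as a complex linear endomorphism, in the complex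
coordinates zeta. Its diagonal entries are - i w(e_1, e_2), - i w(e_3, e_4) and
- i w(e_5, e_6), so that its trace is - i times the trace of w. *)
Definition bracket_cmx (a b : 'I_3) : R[i] :=
  (w (e (re_index a)) (e (re_index b))
   +i* (- w (e (re_index a)) (e (im_index b))))%C.

Lemma zeta_bracket_mx a X :
  zeta g e a (act g e bracket_mx X) = \sum_b bracket_cmx a b * zeta g e b X.
Proof.
have zetaE Y : zeta g e a Y =
  (coframe g e (re_index a) Y +i* coframe g e (im_index a) Y)%C by [].
have eim c : e (im_index c) = - J (e (re_index c)) by rewrite frame_J opprK.
have wim Y : w (e (im_index a)) Y = w (e (re_index a)) (J Y).
  by rewrite eim (scalar_formN (wl Y)) bracket_form_J_skew opprK.
have wimim b : w (e (im_index a)) (e (im_index b)) =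
    w (e (re_index a)) (e (re_index b)).
  rewrite !eim (scalar_formN (wl _)) (scalar_formN (wr _)) opprK.
  exact: bracket_form_J.
have wexp i : w (e i) X = \sum_b
    (coframe g e (re_index b) X * w (e i) (e (re_index b))
     + coframe g e (im_index b) X * w (e i) (e (im_index b))).
  rewrite {1}(orthonormal_expansion hg eo X) (scalar_form_sum (wr _)).
  exact: sum_re_im.
have cE (x y : R) : (x +i* y)%C = x%:C%C + 'i%C * y%:C%C.
  by rewrite [LHS]complexE.
rewrite zetaE !coframe_bracket_mx cE !wexp !raddf_sum mulr_sumr -big_split /=.
apply: eq_bigr => b _.
rewrite wimim wim frame_J (scalar_formN (wr _)) -cE.
rewrite /bracket_cmx; apply/eqP; rewrite eq_complex /=.
by apply/andP; split; apply/eqP; ring.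
Qed.

Hypothesis htr : w (e o1) (e o2) + w (e o3) (e o4) + w (e o5) (e o6) = 0.

Lemma trace_bracket_cmx : \sum_a bracket_cmx a a = 0.
Proof.
have w0 v : w v v = 0 by have := rob_alt hw v v; lra.
rewrite sum_ord3 /bracket_cmx !w0; apply/eqP; rewrite eq_complex /=.
by rewrite !addr0 eqxx -!opprD htr oppr0 eqxx.
Qed.

(** A complex linear endomorphism acts on the complex volume form Psi by its
trace. *)
Lemma bracket_mx_Psi X Y Z :
  Psi g e (act g e bracket_mx X) Y Z + Psi g e X (act g e bracket_mx Y) Z
  + Psi g e X Y (act g e bracket_mx Z) = 0.
Proof.
transitivity ((\sum_a bracket_cmx a a) * Psi g e X Y Z); last first.
  by rewrite trace_bracket_cmx mul0r.
by rewrite !Psi_expansion /= !zeta_bracket_mx !sum_ord3; ring.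
Qed.

(** * A line of instantons through the Bismut connection *)

Definition rank_one_connection (lambda : R) : connection R :=
  fun i j X => lambda * g z X * w (e i) (e j).

Lemma bismut_eq : bismut br J g e = rank_one_connection 1.
Proof.
apply/funext => i; apply/funext => j; apply/funext => X.
rewrite /bismut /rank_one_connection bismut_rank_one (rob_alt hw (e j)); ring.
Qed.

(** The quadratic part of the curvature vanishes because all values of the
connection are proportional to one matrix. *)
Lemma curvature_rank_one lambda i j X Y :
  curvature br (rank_one_connection lambda) i j X Y =
  - lambda * g z z * w (e i) (e j) * w X Y.
Proof.
rewrite /curvature big1 => [|k _]; last first.
  by rewrite /wedge11 /rank_one_connection; ring.
rewrite /d1 /rank_one_connection (rob_eq hw) (scalar_formZ (gr _)); ring.
Qed.

Lemma act_rank_one lambda U V :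
  act g e (conn_mx (rank_one_connection lambda) U) V =
  (lambda * g z U) *: act g e bracket_mx V.
Proof.
apply: (coframe_inj hg he) => i; rewrite [RHS](scalar_formZ (gr _)).
rewrite -/(coframe g e i _) !(coframe_act hg he) mulr_sumr.
by apply: eq_bigr => j _; rewrite !mxE /rank_one_connection !mulrA.
Qed.

Lemma rank_one_preserves_F lambda :
  preserves_F J g e (rank_one_connection lambda).
Proof.
move=> U X Y; rewrite !act_rank_one.
set k := lambda * _.
have FZl V W : fundamental_form J g (k *: V) W = k * fundamental_form J g V W.
  by rewrite !(af_F he) /wedge11 /coframe !(scalar_formZ (gr _)); ring.
have FZr V W : fundamental_form J g V (k *: W) = k * fundamental_form J g V W.
  by rewrite !(af_F he) /wedge11 /coframe !(scalar_formZ (gr _)); ring.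
by rewrite FZl FZr -mulrDr bracket_mx_F mulr0.
Qed.

Lemma rank_one_preserves_Psi lambda :
  preserves_Psi g e (rank_one_connection lambda).
Proof.
move=> U X Y Z; rewrite !act_rank_one.
set k := lambda * _.
have zZ a V : zeta g e a (k *: V) = k%:C%C * zeta g e a V.
  rewrite /zeta /coframe !(scalar_formZ (gr _)).
  apply/eqP; rewrite eq_complex /= !mul0r subr0 addr0.
  by apply/andP; split; apply/eqP.
rewrite -[RHS](mulr0 k%:C%C) -(bracket_mx_Psi X Y Z) !Psi_expansion /= !zZ.
ring.
Qed.

Definition bracket_norm2 :=
  \sum_(i < 6) \sum_(j < 6 | (i < j)%N) w (e i) (e j) ^+ 2.

Lemma p1_rank_one lambda X Y Z W :
  p1 br (rank_one_connection lambda) X Y Z W =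
  (8 * pi ^+ 2)^-1 *
  (lambda ^+ 2 * g z z ^+ 2 * bracket_norm2 * wedge22 w w X Y Z W).
Proof.
rewrite /p1; congr (_ * _).
rewrite /bracket_norm2 mulr_sumr mulr_suml; apply: eq_bigr => i _.
rewrite mulr_sumr mulr_suml; apply: eq_bigr => j _.
rewrite /wedge22 !curvature_rank_one; ring.
Qed.

Lemma bracket_form_expansion X Y :
  w X Y = \sum_i \sum_j g (e i) X * g (e j) Y * w (e i) (e j).
Proof.
rewrite {1}(orthonormal_expansion hg eo X) (scalar_form_sum (wl Y)).
apply: eq_bigr => i _; rewrite {1}(orthonormal_expansion hg eo Y).
rewrite (scalar_form_sum (wr _)) mulr_sumr.
by apply: eq_bigr => j _; rewrite mulrA.
Qed.

Lemma bracket_frame_neq0 : (exists x y, w x y != 0) ->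
  exists i j : 'I_6, (i < j)%N /\ w (e i) (e j) != 0.
Proof.
move=> [x [y /negP wxy]]; apply: contrapT => h; apply: wxy.
have w0 (i j : 'I_6) : (i < j)%N -> w (e i) (e j) = 0.
  by move=> ij; apply/eqP; apply: contraT => wij; case: h; exists i, j.
rewrite bracket_form_expansion big1 // => i _; rewrite big1 // => j _.
case: (ltngtP i j) => [ij|ji|/val_inj ->].
- by rewrite w0 ?mulr0.
- by rewrite (rob_alt hw) w0 ?oppr0 ?mulr0.
suff -> : w (e j) (e j) = 0 by rewrite mulr0.
by have := rob_alt hw (e j) (e j) => ?; lra.
Qed.

Lemma bracket_norm2_gt0 : (exists x y, w x y != 0) -> 0 < bracket_norm2.
Proof.
move=> /bracket_frame_neq0 [i [j [ij wij]]].
have pos (k : 'I_6) : 0 <= \sum_(l < 6 | (k < l)%N) w (e k) (e l) ^+ 2.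
  by apply: sumr_ge0 => l _; exact: sqr_ge0.
rewrite /bracket_norm2 (bigD1 i) //= ltr_wpDr ?sumr_ge0 //.
rewrite (bigD1 j) //= ltr_wpDr ?sumr_ge0 // => [l _|]; first exact: sqr_ge0.
by rewrite exprn_even_gt0.
Qed.

Lemma rank_one_curvature_su3 lambda :
  curvature_in_su3 br J e (rank_one_connection lambda).
Proof.
move=> i j; split=> [|k l]; rewrite !curvature_rank_one ?bracket_form_J //.
by rewrite -!mulrDr htr mulr0.
Qed.

Lemma rank_one_instanton lambda :
  su3_instanton br J g e (rank_one_connection lambda).
Proof.
split.
- move=> i j a X Y; rewrite /rank_one_connection (gr _); ring.
- exact: rank_one_preserves_F.
- exact: rank_one_preserves_Psi.
- exact: rank_one_curvature_su3.
Qed.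

End Frame.
End RankOneGeometry.

(** * The Strominger system and the heterotic equations *)

Theorem theorem5p3 (R : realType)
  (br : 'rV[R]_6 -> 'rV[R]_6 -> 'rV[R]_6) (Gam : set 'rV[R]_6)
  (J : 'rV[R]_6 -> 'rV[R]_6) (g : 'rV[R]_6 -> 'rV[R]_6 -> R)
  (hbr : lie_bracket br) (hh3 : isomorphic_to_h3 br) (hGam : lattice br Gam)
  (hJF : hermitian_structure br J g) (hbal : balanced br J g) :
  (exists e : 'I_6 -> 'rV[R]_6, adapted_frame J g e) /\
  (forall e : 'I_6 -> 'rV[R]_6, adapted_frame J g e ->
    [/\ exists A : connection R, solves_strominger br J g e Gam A,
        curvature_in_su3 br J e (bismut br J g e)
      & forall A : connection R, solves_strominger br J g e Gam A ->
          solves_heterotic br J g e Gam A]).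
Proof.
split; first exact: adapted_frame_exists hJF.
move=> e he.
have [w [z [hw z0 wn0]]] := h3_rank_one hh3.
have htr := balanced_bracket_form_trace hJF hw z0 he hbal.
have inst lambda : su3_instanton br J g e (rank_one_connection g w z e lambda).
  exact: (rank_one_instanton hJF hw z0 he htr).
have bE : bismut br J g e = rank_one_connection g w z e 1.
  exact: (bismut_eq hJF hw z0 e).
have hB : su3_instanton br J g e (bismut br J g e) by rewrite bE.
split; [|exact: inst_curvature hB|by move=> A].
have [i [j [_ wij]]] := bracket_frame_neq0 hJF hw he wn0.
have zz0 : 0 < g z z := ip_pos (herm_metric hJF) z0.
have N0 := bracket_norm2_gt0 hJF hw he wn0.
exists (rank_one_connection g w z e 2^-1); split=> //.
- move=> P [c _]; apply: (transport_preserves (herm_metric hJF) he).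
    exact: inst_F hB.
  exact: inst_Psi hB.
- exists i, j, (e i), (e j); rewrite (curvature_rank_one hJF hw).
  by rewrite !mulf_neq0 ?oppr_eq0 ?invr_eq0 ?pnatr_eq0 // gt_eqF.
(* For A = lambda sigma the anomaly equation is
   |z|^2 = alpha' / 4 * (1 - lambda^2) N |z|^4, here with lambda = 1/2. *)
exists (16 / (3 * bracket_norm2 w e * g z z)).
  by rewrite divr_gt0 ?mulr_gt0 ?ltr0n.
move=> X Y Z W; rewrite bE (d_torsion_rank_one hJF hw z0).
rewrite !(p1_rank_one hJF hw).
have pi0 : (pi : R) != 0 by rewrite gt_eqF // pi_gt0.
move: (pi : R) pi0 => p p0.
by field; rewrite p0 !gt_eqF.
Qed.
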